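(* Let $K$ and $M$ be $n\times n$ real symmetric positive definite matrices, let $\mathcal P\subset\mathbb R^n$ be a subspace of dimension $m<n$, and let $P\in\mathbb R^{n\times m}$ be a matrix whose columns form a basis of $\mathcal P$. Let $\Lambda_{\pm i}$ be the Ritz values, i.e. the $m$ eigenvalues of $P^tKPy=\Lambda\,P^tMPy$. For any choice of positive integers $\nu,\pi$ with $\nu+\pi=m$ and any matrix pair $(A,B)\in\mathcal C(\mathcal P)$, $$\lambda_k(A,B)\le\Lambda_k\quad\text{for }k=1,2,\dots,\nu,\qquad \Lambda_{-\ell}\le\lambda_{-\ell}(A,B)\quad\text{for }\ell=1,2,\dots,\pi.$$ Furthermore, for each such index pair $\nu,\pi$ there exists a matrix pair $(\hat A,\hat B)\in\mathcal C(\mathcal P)$ such that $$\lambda_k(\hat A,\hat B)=\Lambda_k\quad\text{for }k=1,2,\dots,\nu,\qquad \Lambda_{-\ell}=\lambda_{-\ell}(\hat A,\hat B)\quad\text{for }\ell=1,2,\dots,\pi.$$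
   Context: Labeling convention: the real eigenvalues of an eigenvalue problem, counted with multiplicity, are labeled from the edges toward the center, $\mu_1\le\mu_2\le\dots\le\mu_{-2}\le\mu_{-1}$; that is, $\mu_k$ is the $k$-th smallest and $\mu_{-\ell}$ is the $\ell$-th largest eigenvalue. For real symmetric positive definite $A,B$, $\lambda_{k}(A,B)$ and $\lambda_{-\ell}(A,B)$ denote the eigenvalues, so labeled, of the pencil $A-\lambda B$ (i.e. of $Ax=\lambda Bx$). $\mathcal C(\mathcal P)$ is the set of pairs $(A,B)$ of $n\times n$ real symmetric positive definite matrices such that $P^t(A-K)P=0$ and $P^t(B-M)P=0$. *)

(* Defs.v *)
From HB Require Import structures.
From mathcomp Require Import all_boot all_order all_algebra.
From mathcomp Require Import reals.
From mathcomp Require Import polyrcf.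

Set Implicit Arguments.
Unset Strict Implicit.
Unset Printing Implicit Defensive.

Import Order.TTheory GRing.Theory Num.Theory.

Local Open Scope ring_scope.

Definition spd (R : realType) (n : nat) (A : 'M[R]_n) : Prop :=
  A \is symmetricmx /\
  forall x : 'cV[R]_n, x != 0 -> 0 < (x^T *m A *m x) 0 0.

Definition pencil_poly (R : realType) (n : nat) (A B : 'M[R]_n) : {poly R} :=
  \det (map_mx polyC A - 'X *: map_mx polyC B).

(* [rootsR] lists every real root once; [mup] restores the multiplicities.
   For symmetric A and positive definite B, these agree with the dimensions of
   the spaces of solutions x of A x = mu B x. *)
Definition pencil_eigs (R : realType) (n : nat) (A B : 'M[R]_n) : seq R :=
  let p := pencil_poly A B in
  sort <=%R (flatten [seq nseq (mup mu p) mu | mu <- rootsR p]).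

(* Indices k and l start at 1. *)
Definition eig_low (R : realType) (n : nat) (A B : 'M[R]_n) (k : nat) : R :=
  nth 0 (pencil_eigs A B) k.-1.

Definition eig_high (R : realType) (n : nat) (A B : 'M[R]_n) (l : nat) : R :=
  nth 0 (rev (pencil_eigs A B)) l.-1.

Definition constrained_pair (R : realType) (n m : nat) (K M : 'M[R]_n)
    (P : 'M[R]_(n, m)) (A B : 'M[R]_n) : Prop :=
  [/\ spd A, spd B, P^T *m (A - K) *m P = 0 & P^T *m (B - M) *m P = 0].

Lemma root_pencil_poly (R : realType) (n : nat) (A B : 'M[R]_n) (mu : R) :
  root (pencil_poly A B) mu <->
  exists2 x : 'cV[R]_n, x != 0 & A *m x = mu *: (B *m x).
Proof.
have -> : root (pencil_poly A B) mu = (\det (A - mu *: B) == 0).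
  rewrite /root /pencil_poly -horner_evalE -det_map_mx; congr (\det _ == 0).
  by apply/matrixP => i j; rewrite !mxE /= /horner_eval !hornerE.
rewrite -det_tr; split=> [/det0P[v v0 vA] | [x x0 Ax]].
  exists v^T; first by rewrite trmx_eq0.
  apply/eqP; rewrite -subr_eq0 scalemxAl -mulmxBl.
  by rewrite -trmx_eq0 trmx_mul trmxK vA.
apply/det0P; exists x^T; first by rewrite trmx_eq0.
by rewrite -trmx_mul mulmxBl -scalemxAl Ax subrr trmx0.
Qed.

Lemma count_pencil_eigs (R : realType) (n : nat) (A B : 'M[R]_n) (mu : R) :
  pencil_poly A B != 0 ->
  count_mem mu (pencil_eigs A B) = mup mu (pencil_poly A B).
Proof.
move=> p0; rewrite /pencil_eigs (permP (permEl (perm_sort _ _))) count_flatten.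
rewrite -map_comp sumnE big_map.
under eq_bigr => y _ do rewrite /= count_nseq /=.
have [mur|muNr] := boolP (mu \in rootsR (pencil_poly A B)).
  rewrite (bigD1_seq mu) ?uniq_roots //= eqxx mul1n big1 ?addn0 // => y.
  by move=> /negPf->.
rewrite big1_seq => [|y /= yr].
  by rewrite mupNroot //; move: muNr; rewrite -(roots_on_rootsR p0) in_itv.
by case: eqVneq yr muNr => // -> ->.
Qed.

(* Main.v *)
Require Import Defs.
From mathcomp Require Import all_boot all_order all_algebra.
From mathcomp Require Import reals.
From mathcomp Require Import complex.

(** The pencil [A - mu B], with [A] symmetric and [B] positive definite, is
    diagonal in suitable coordinates: there is an invertible [W] such that
    [W B W^T] is the identity and [W A W^T] is diagonal with entries [d]
    ([spd_pencil_diag]), and [pencil_eigs A B] is then [d] in increasing order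
    ([pencil_eigs_diag]).  All matrices act on row vectors, so that [P] enters
    through [P^T], whose rows are independent.

    Interlacing.  The constraints say that [(A, B)] and [(K, M)] have the same
    compression to the range of [P], so that the Ritz values are those of
    [(A, B)] as well.  Expressed in the diagonalizing coordinates of
    [(P^T A P, P^T B P)] and of [(A, B)], the inclusion of the range of [P] is a
    matrix [F] with [F F^T = 1] and [F diag(d) F^T = diag(e)], where [e] lists
    the Ritz values.  For every [t], the span of the coordinates with [e_j <= t]
    is mapped injectively into vectors at which the form [d - t] is nonpositive,
    so its image meets the span of the coordinates with [d_i > t] only in 0.  By
    dimension count at least as many [d_i] as [e_j] are at most [t]
    ([isometry_count_le]); changing the signs of [d], [e] and [t] shows that at
    least as many [d_i] as [e_j] are at least [t] ([isometry_count_ge]).  Taking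
    [t] to be a Ritz value yields the inequalities ([eig_low_compress],
    [eig_high_compress]).

    Attainment.  Complete a diagonalizing basis of the range of [P] to a basis
    of the whole space, and let the new pair be, in that basis, the identity and
    the diagonal matrix with entries the Ritz values followed by [n - m] copies
    of [Lambda_nu] ([exists_pair_repeating_eig]).  The compression is unchanged,
    positivity holds because the Ritz values are positive, and in the sorted
    spectrum the extra copies sit right after the first [nu] Ritz values
    ([sort_cat_nseq]), so the first [nu] and the last [pi = m - nu] entries are
    those of the list of Ritz values. *)

Set Implicit Arguments.
Unset Strict Implicit.
Unset Printing Implicit Defensive.

Import Order.TTheory GRing.Theory Num.Theory.

Local Open Scope ring_scope.

(** * Symmetric and positive definite matrices under congruence *)

Lemma symmetricmxP (R : realType) n (A : 'M[R]_n) :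
  reflect (A^T = A) (A \is symmetricmx).
Proof.
by apply: (iffP (is_hermitianmxP _ _ _));
  rewrite expr0 scale1r map_mx_id // => {1}->.
Qed.

Lemma symmetricmx_congr (R : realType) n k (A : 'M[R]_n) (Q : 'M[R]_(k, n)) :
  A \is symmetricmx -> Q *m A *m Q^T \is symmetricmx.
Proof.
move=> /symmetricmxP As; apply/symmetricmxP.
by rewrite !trmx_mul trmxK As mulmxA.
Qed.

Lemma spd_row_gt0 (R : realType) n (B : 'M[R]_n) (v : 'rV[R]_n) :
  spd B -> v != 0 -> 0 < (v *m B *m v^T) 0 0.
Proof.
by move=> [_ Bp] v0; have := Bp v^T; rewrite trmxK trmx_eq0; apply.
Qed.

(** The quadratic form of [Q B Q^T] is that of [B] pulled back along
    [x |-> x Q], which is injective since the rows of [Q] are independent. *)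
Lemma spd_congr (R : realType) n k (B : 'M[R]_n) (Q : 'M[R]_(k, n)) :
  spd B -> row_free Q -> spd (Q *m B *m Q^T).
Proof.
move=> Bp Qf; split; first exact: symmetricmx_congr (proj1 Bp).
move=> x x0; have := @spd_row_gt0 _ _ B (x^T *m Q) Bp.
rewrite trmx_mul trmxK !mulmxA; apply.
by rewrite mulmx_free_eq0 // trmx_eq0.
Qed.

Lemma spd_unit (R : realType) n (B : 'M[R]_n) : spd B -> B \in unitmx.
Proof.
move=> Bp; rewrite -row_free_unit -kermx_eq0; apply/rowV0P => v /sub_kermxP vB.
apply/eqP; apply: contraT => /(spd_row_gt0 Bp).
by rewrite vB mul0mx mxE ltxx.
Qed.

Lemma diag_form (R : realType) n (d z : 'rV[R]_n) :
  (z *m diag_mx d *m z^T) 0 0 = \sum_i d 0 i * z 0 i ^+ 2.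
Proof.
rewrite mxE; apply: eq_bigr => i _.
by rewrite mul_mx_diag !mxE expr2 mulrA [d _ _ * _]mulrC.
Qed.

Lemma spd_diag_mx (R : realType) n (d : 'rV[R]_n) :
  spd (diag_mx d) <-> forall i, 0 < d 0 i.
Proof.
split=> [dp i | d0].
  have := @spd_row_gt0 _ _ _ (delta_mx 0 i) dp.
  rewrite diag_form (bigD1 i) //= big1 ?addr0 => [|j ji].
    rewrite mxE !eqxx expr1n mulr1; apply.
    by apply/eqP=> /matrixP/(_ 0 i)/eqP; rewrite !mxE !eqxx oner_eq0.
  by rewrite mxE (negPf ji) andbF expr0n mulr0.
split; first by apply/symmetricmxP; rewrite tr_diag_mx.
move=> x x0; rewrite -{2}[x]trmxK diag_form.
have s0 i : true -> 0 <= d 0 i * x^T 0 i ^+ 2.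
  by move=> _; rewrite mulr_ge0 ?sqr_ge0 // ltW.
rewrite lt_def sumr_ge0 // andbT psumr_neq0 //.
have [i xi] : exists i, x^T 0 i != 0 by apply/rV0Pn; rewrite trmx_eq0.
apply/hasP; exists i; rewrite ?mem_index_enum //=.
by rewrite mulr_gt0 // exprn_even_gt0.
Qed.

Lemma unit_of_congr1 (R : realType) n (B W : 'M[R]_n) :
  W *m B *m W^T = 1%:M -> W \in unitmx.
Proof. by rewrite -mulmxA => /mulmx1_unit[]. Qed.

(** Gaussian elimination writes [Q] as [L (1 | 0) U] with [L] and [U]
    invertible, so [Q] is the top block of [diag(L, 1) U]. *)
Lemma row_free_extend (R : realType) m q (Q : 'M[R]_(m, m + q)) :
  row_free Q -> exists2 U : 'M[R]_(m + q), U \in unitmx & usubmx U = Q.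
Proof.
move=> Qf; exists (block_mx (col_ebase Q) 0 0 1%:M *m row_ebase Q).
  by rewrite unitmx_mul block_diag_mx_unit col_ebase_unit unitmx1 row_ebase_unit.
rewrite -[RHS]mulmx_ebase (eqP Qf) pid_mx_row.
rewrite -mul_usub_mx /block_mx col_mxKu mul_mx_row.
by rewrite mulmx1 mulmx0.
Qed.

(** * Simultaneous diagonalization of a definite pencil *)

Lemma map_Re_mulmx (R : realType) m n p (v : 'M[R[i]]_(m, n)) (A : 'M[R]_(n, p)) :
  map_mx (@complex.Re R) (v *m map_mx (real_complex R) A) =
  map_mx (@complex.Re R) v *m A.
Proof.
apply/matrixP => i j; rewrite !mxE raddf_sum; apply: eq_bigr => k _ /=.
by rewrite !mxE; case: (v i k) => a b /=; rewrite mulr0 subr0.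
Qed.

Lemma map_Im_mulmx (R : realType) m n p (v : 'M[R[i]]_(m, n)) (A : 'M[R]_(n, p)) :
  map_mx (@complex.Im R) (v *m map_mx (real_complex R) A) =
  map_mx (@complex.Im R) v *m A.
Proof.
apply/matrixP => i j; rewrite !mxE raddf_sum; apply: eq_bigr => k _ /=.
by rewrite !mxE; case: (v i k) => a b /=; rewrite mulr0 add0r.
Qed.

(** A complex eigenvector [x + i y] exists because [R[i]] is algebraically
    closed.  Its eigenvalue [s + i t] is real: [x A = s x B - t y B] and
    [y A = t x B + s y B], so the symmetry [x A y^T = y A x^T] reduces to
    [t (x B x^T + y B y^T) = 0], where the second factor is positive.  Then [x]
    and [y] both satisfy the real eigenvector equation, and one of them is
    nonzero. *)
Lemma pencil_eigenvector (R : realType) n (A B : 'M[R]_n) :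
  (0 < n)%N -> A \is symmetricmx -> spd B ->
  exists mu, exists2 v : 'rV[R]_n, v != 0 & v *m A = mu *: (v *m B).
Proof.
move=> n0 As Bp; have Bu := spd_unit Bp; have /symmetricmxP Bs := proj1 Bp.
have [a /eigenvalueP[v vA v0]] :=
  eigenvalue_closed (map_mx (real_complex R) (A *m invmx B)) n0.
have {}vA : v *m map_mx (real_complex R) A = a *: (v *m map_mx (real_complex R) B).
  by rewrite scalemxAl -vA -mulmxA -map_mxM mulmxKV.
set x := map_mx (@complex.Re R) v; set y := map_mx (@complex.Im R) v.
case: a vA => s t vA.
have xA : x *m A = s *: (x *m B) - t *: (y *m B).
  rewrite /x /y -!map_Re_mulmx -map_Im_mulmx vA.
  by apply/matrixP => i j; rewrite !mxE; case: (\sum_ _ _).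
have yA : y *m A = t *: (x *m B) + s *: (y *m B).
  rewrite /x /y -!map_Im_mulmx -map_Re_mulmx vA.
  apply/matrixP => i j; rewrite !mxE; case: (\sum_ _ _) => a b /=.
  by rewrite addrC.
have form_sym (C : 'M[R]_n) (z w : 'rV[R]_n) : C^T = C ->
    (z *m C *m w^T) 0 0 = (w *m C *m z^T) 0 0.
  by move=> Cs; rewrite -[_ *m w^T]trmxK mxE !trmx_mul trmxK Cs mulmxA.
have xy0 : (x != 0) || (y != 0).
  rewrite -negb_and; apply: contra v0 => /andP[/eqP x0 /eqP y0].
  apply/eqP/matrixP => i j; rewrite mxE.
  move/matrixP/(_ i j): x0; move/matrixP/(_ i j): y0; rewrite !mxE.
  by case: (v i j) => a b /= -> ->.
have form_ge0 (z : 'rV[R]_n) : 0 <= (z *m B *m z^T) 0 0.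
  have [->|/(spd_row_gt0 Bp)/ltW//] := eqVneq z 0.
  by rewrite !mul0mx mxE.
have lin a b (u w z : 'rV[R]_n) :
    ((a *: u + b *: w) *m z^T) 0 0 = a * (u *m z^T) 0 0 + b * (w *m z^T) 0 0.
  by rewrite mulmxDl -!scalemxAl mxE [X in X + _]mxE [X in _ + X]mxE.
have t0 : t = 0.
  have := form_sym A x y (elimT (symmetricmxP _) As).
  rewrite xA yA -scaleNr !lin (form_sym B y x Bs) [RHS]addrC => /addrI/eqP.
  rewrite eq_sym mulNr -subr_eq0 opprK -mulrDr.
  rewrite mulf_eq0 => /orP[/eqP//|].
  rewrite paddr_eq0 // => /andP[/eqP xB /eqP yB].
  by case/orP: xy0 => /(spd_row_gt0 Bp); rewrite ?xB ?yB ltxx.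
exists s; case/orP: xy0 => z0.
  by exists x; rewrite // xA t0 scale0r subr0.
by exists y; rewrite // yA t0 scale0r add0r.
Qed.

(** Induction by deflation: pick an eigenvector [v], complete it to a basis, and
    subtract from the other basis vectors their [B]-projections on [v].  The
    resulting rows [Z] satisfy [Z B v^T = 0], hence also [Z A v^T = 0] because
    [v A] is proportional to [v B]; the pencil splits into the span of [v] and
    the smaller pencil [(Z A Z^T, Z B Z^T)]. *)
Lemma spd_pencil_diag (R : realType) n (A B : 'M[R]_n) :
  A \is symmetricmx -> spd B ->
  exists W (d : 'rV[R]_n), W *m B *m W^T = 1%:M /\ W *m A *m W^T = diag_mx d.
Proof.
elim: n A B => [|n IHn] A B As Bp.
  by exists 1%:M, 0; split; rewrite [LHS]flatmx0 [RHS]flatmx0.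
have [mu [v v0 vA]] := pencil_eigenvector (ltn0Sn n) As Bp.
have /symmetricmxP Bs := proj1 Bp.
have vf : row_free (v : 'M_(1, 1 + n)) by rewrite /row_free rank_rV v0.
have [U Uu Uv] := row_free_extend vf.
set b := (v *m B *m v^T) 0 0.
have b0 : 0 < b by exact: spd_row_gt0.
pose Y : 'M[R]_(n, n.+1) := dsubmx (U : 'M_(1 + n)).
pose c := - (b^-1 *: (Y *m B *m v^T)).
pose Z := c *m v + Y.
have ZBv : Z *m B *m v^T = 0.
  rewrite !mulmxDl -[c *m v *m B]mulmxA -[c *m _ *m _]mulmxA.
  rewrite [v *m B *m v^T]mx11_scalar -/b mul_mx_scalar scalerN scalerA.
  by rewrite divff ?gt_eqF // scale1r addNr.
have vBZ : v *m B *m Z^T = 0.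
  by apply: trmx_inj; rewrite !trmx_mul trmxK Bs mulmxA ZBv trmx0.
have vAZ : v *m A *m Z^T = 0 by rewrite vA -scalemxAl vBZ scaler0.
have ZAv : Z *m A *m v^T = 0.
  apply: trmx_inj; rewrite !trmx_mul trmxK (elimT (symmetricmxP A) As).
  by rewrite mulmxA vAZ trmx0.
have Zf : row_free Z.
  rewrite -kermx_eq0; apply/rowV0P => w /sub_kermxP wZ.
  have : row_mx (w *m c) w *m U = 0.
    by rewrite -[U]vsubmxK Uv mul_row_col -mulmxA -mulmxDr.
  move/(congr1 (mulmx^~ (invmx U))); rewrite mulmxK // mul0mx.
  by rewrite -row_mx0 => /eq_row_mx[].
have [W [d [WB WA]]] :=
  IHn _ _ (symmetricmx_congr Z As) (spd_congr Bp Zf).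
(* Rescaling [v] by [r] makes its [B]-norm equal to 1. *)
pose r := Num.sqrt b^-1.
have rr : r * r = b^-1 by rewrite -expr2 sqr_sqrtr // invr_ge0 ltW.
exists (col_mx (r *: v) (W *m Z) : 'M_(1 + n)), (row_mx mu%:M d : 'rV_(1 + n)).
have form1 C : (r *: v) *m C *m (r *: v)^T = (b^-1 * (v *m C *m v^T) 0 0)%:M.
  rewrite linearZ /= -scalemxAr -!scalemxAl scalerA rr.
  by rewrite [in LHS](mx11_scalar (v *m C *m v^T)) scale_scalar_mx.
have block C : v *m C *m Z^T = 0 -> Z *m C *m v^T = 0 ->
    (col_mx (r *: v) (W *m Z) : 'M_(1 + n)) *m C *m (col_mx (r *: v) (W *m Z))^T =
    block_mx (b^-1 * (v *m C *m v^T) 0 0)%:M 0 0 (W *m (Z *m C *m Z^T) *m W^T).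
  move=> vCZ ZCv; rewrite tr_col_mx mul_col_mx mul_col_row form1.
  congr block_mx.
  - by rewrite trmx_mul -!scalemxAl mulmxA vCZ mul0mx scaler0.
  - by rewrite linearZ /= -scalemxAr -!mulmxA [Z *m _]mulmxA ZCv mulmx0 scaler0.
  - by rewrite trmx_mul !mulmxA.
split.
  by rewrite block // WB mulVf ?gt_eqF // [RHS](@scalar_mx_block _ 1 n).
rewrite block // WA [RHS](@diag_mx_row _ n 1) vA -scalemxAl [X in b^-1 * X]mxE -/b.
rewrite mulrCA mulVf ?gt_eqF // mulr1.
rewrite (_ : diag_mx (mu%:M : 'rV_1) = mu%:M) //.
by apply/matrixP => i j; rewrite !mxE !ord1 eqxx.
Qed.

(** * The spectrum as the sorted diagonal *)

(** [det W ^ 2 * det (A - X B)] is the determinant of the diagonal matrix with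
    entries [d_i - X]. *)
Lemma pencil_poly_diag (R : realType) n (A B W : 'M[R]_n) (d : 'rV[R]_n) :
  W *m B *m W^T = 1%:M -> W *m A *m W^T = diag_mx d ->
  exists2 c, c != 0 & pencil_poly A B = c *: \prod_i ('X - (d 0 i)%:P).
Proof.
move=> WB WA.
have W0 : \det W != 0.
  by rewrite -unitfE -unitmxE (unit_of_congr1 WB).
have E : (\det W ^+ 2)%:P * pencil_poly A B =
    (-1) ^+ n * \prod_i ('X - (d 0 i)%:P).
  rewrite rmorphXn /= -det_map_mx expr2 -mulrA [_ * pencil_poly _ _]mulrC mulrA.
  rewrite -[in X in _ * X = _]det_tr -!det_mulmx mulmxBr mulmxBl.
  rewrite -scalemxAr -scalemxAl map_trmx -!map_mxM /= WA WB map_diag_mx map_mx1.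
  rewrite -diag_const_mx -linearZ -linearB det_diag.
  have -> : (-1) ^+ n = \prod_(i < n) (-1) :> {poly R}.
    by rewrite prodr_const card_ord.
  rewrite -big_split; apply: eq_bigr => i _.
  by rewrite !mxE /= mulr1 mulN1r opprB.
exists ((\det W ^+ 2)^-1 * (-1) ^+ n).
  by rewrite mulf_neq0 ?invr_eq0 ?expf_neq0 // oppr_eq0 oner_eq0.
rewrite -mul_polyC polyCM rmorphXn rmorphN rmorph1 -mulrA -E mulrA -polyCM.
by rewrite mulVf ?expf_neq0 // mul1r.
Qed.

Lemma mup_prod_XsubC (R : realType) (s : seq R) x :
  mup x (\prod_(y <- s) ('X - y%:P)) = count_mem x s.
Proof.
elim: s => [|y s IHs]; first by rewrite big_nil mupNroot // root1.
rewrite big_cons mupM ?polyXsubC_eq0 ?monic_neq0 ?monic_prod_XsubC //=.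
rewrite IHs -['X - _]expr1 mup_XsubCX; by case: eqP.
Qed.

Lemma pencil_eigs_diag (R : realType) n (A B W : 'M[R]_n) (d : 'rV[R]_n) :
  W *m B *m W^T = 1%:M -> W *m A *m W^T = diag_mx d ->
  pencil_eigs A B = sort <=%R (codom (d 0)).
Proof.
move=> WB WA; have [c c0 pE] := pencil_poly_diag WB WA.
have prodE : \prod_i ('X - (d 0 i)%:P) = \prod_(y <- codom (d 0)) ('X - y%:P).
  by rewrite big_map enumT.
have p0 : pencil_poly A B != 0.
  by rewrite pE prodE scaler_eq0 negb_or c0 monic_neq0 ?monic_prod_XsubC.
apply: (sorted_eq le_trans le_anti); rewrite ?sort_le_sorted //.
rewrite perm_sym perm_sort perm_sym; apply/allP => x _ /=.
rewrite count_pencil_eigs // pE prodE -mul_polyC mupMr ?rootC //.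
by rewrite mup_prod_XsubC.
Qed.

Lemma size_pencil_eigs (R : realType) n (A B : 'M[R]_n) :
  A \is symmetricmx -> spd B -> size (pencil_eigs A B) = n.
Proof.
move=> As Bp; have [W [d [WB WA]]] := spd_pencil_diag As Bp.
by rewrite (pencil_eigs_diag WB WA) size_sort size_codom card_ord.
Qed.

(** * Interlacing by counting eigenvalues *)

Lemma count_codom (R : realType) n (d : 'rV[R]_n) (p : pred R) :
  count p (codom (d 0)) = #|[pred i | p (d 0 i)]|.
Proof. by rewrite count_map cardE size_filter enumT. Qed.

(** This is Cauchy interlacing in counting form.  If more [e_j] than [d_i] were
    at most [t], linear algebra would give a nonzero [y] supported on the [j] with
    [e_j <= t] whose image [z = y F] vanishes on the [i] with [d_i <= t].  Since
    [F] is isometric and carries the form [d] to the form [e],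
    [\sum_i (d_i - t) z_i^2 = \sum_j (e_j - t) y_j^2 <= 0], while the terms on the
    left are nonnegative and vanish only if [z_i = 0].  So [z = 0] and
    [y = z F^T = 0], a contradiction. *)
Lemma isometry_count_le (R : realType) k n (F : 'M[R]_(k, n)) (d : 'rV[R]_n)
    (e : 'rV[R]_k) (t : R) :
  F *m F^T = 1%:M -> F *m diag_mx d *m F^T = diag_mx e ->
  (count (<= t)%O (codom (e 0%R)) <= count (<= t)%O (codom (d 0%R)))%N.
Proof.
move=> FF FdF; rewrite !count_codom leqNgt; apply/negP.
set S := [pred j | _ (e 0 j)]; set T := [pred i | _] => lt_card.
pose G := rowsub (@enum_val _ S) F.
have GE : G = rowsub (@enum_val _ S) 1%:M *m F by rewrite mul_rowsub_mx mul1mx.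
(* [w N] lists the coordinates of [y F] at indices of [T], when [w] lists the
   coordinates of [y] at indices of [S]. *)
pose N := colsub (@enum_val _ T) G.
have [w wN w0] : exists2 w : 'rV_#|S|, w *m N = 0 & w != 0.
  have /rowV0Pn[w /sub_kermxP wN w0] : kermx N != 0.
    rewrite kermx_eq0 /row_free neq_ltn.
    by rewrite (leq_ltn_trans (rank_leq_col N)).
  by exists w.
pose y := w *m rowsub (@enum_val _ S) 1%:M.
pose z := y *m F.
have yS j : e 0 j > t -> y 0 j = 0.
  move=> jt; rewrite mxE big1 // => i _; rewrite !mxE.
  case: eqP => [ji|]; last by rewrite mulr0.
  by have := enum_valP i; rewrite ji /S inE /= lt_geF.
have zT i : d 0 i <= t -> z 0 i = 0.
  move=> it; have iT : i \in T by [].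
  move/matrixP/(_ 0 (enum_rank_in iT i)): wN.
  rewrite /z /y -mulmxA -GE [in X in _ = X -> _]mxE => <-.
  by rewrite !mxE; apply: eq_bigr => j _; rewrite !mxE enum_rankK_in.
have sqr p (x : 'rV[R]_p) : (x *m x^T) 0 0 = \sum_i x 0 i ^+ 2.
  by rewrite mxE; apply: eq_bigr => i _; rewrite mxE.
have zz : \sum_i z 0 i ^+ 2 = \sum_j y 0 j ^+ 2.
  by rewrite -!sqr /z trmx_mul mulmxA -[y *m F *m _]mulmxA FF mulmx1.
have zdz : \sum_i d 0 i * z 0 i ^+ 2 = \sum_j e 0 j * y 0 j ^+ 2.
  rewrite -!diag_form -FdF; congr (_ 0 0).
  by rewrite /z trmx_mul !mulmxA.
have z_le0 : \sum_i (d 0 i - t) * z 0 i ^+ 2 <= 0.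
  under eq_bigr do rewrite mulrBl; rewrite sumrB -mulr_sumr zz zdz mulr_sumr.
  rewrite -sumrB; apply: sumr_le0 => j _; rewrite -mulrBl.
  have [jt|jt] := leP (e 0 j) t; last by rewrite yS // expr0n mulr0.
  by rewrite mulr_le0_ge0 ?sqr_ge0 // subr_le0.
have term_ge0 i : true -> 0 <= (d 0 i - t) * z 0 i ^+ 2.
  have [it|it] := leP (d 0 i) t; first by rewrite zT // expr0n mulr0.
  by rewrite mulr_ge0 ?sqr_ge0 // subr_ge0 ltW.
have z0 : z = 0.
  apply/rowP => i; rewrite [RHS]mxE; have [/zT//|it] := leP (d 0 i) t.
  have /eqP/psumr_eq0P/(_ i isT)/eqP : \sum_i (d 0 i - t) * z 0 i ^+ 2 == 0.
    by rewrite eq_le z_le0 sumr_ge0.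
  by rewrite mulf_eq0 subr_eq0 gt_eqF //= sqrf_eq0 => H; apply/eqP/H.
have y0 : y = 0 by rewrite -[y]mulmx1 -FF mulmxA -/z z0 mul0mx.
case/negP: w0; apply/eqP/rowP => s; rewrite mxE.
move/matrixP/(_ 0 (enum_val s)): y0; rewrite !mxE (bigD1 s) //= !mxE eqxx mulr1.
rewrite big1 ?addr0 // => i; rewrite !mxE.
by rewrite (inj_eq enum_val_inj) => /negPf->; rewrite mulr0.
Qed.

Lemma isometry_count_ge (R : realType) k n (F : 'M[R]_(k, n)) (d : 'rV[R]_n)
    (e : 'rV[R]_k) (t : R) :
  F *m F^T = 1%:M -> F *m diag_mx d *m F^T = diag_mx e ->
  (count (>= t)%O (codom (e 0%R)) <= count (>= t)%O (codom (d 0%R)))%N.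
Proof.
move=> FF FdF; have := @isometry_count_le _ _ _ F (- d) (- e) (- t) FF.
rewrite !linearN mulNmx /= FdF !count_codom => /(_ erefl).
by congr (_ <= _)%N; apply: eq_card => i; rewrite !inE mxE lerN2.
Qed.

(** [F] is the inclusion [V P^T] of the compressed space, in the coordinates in
    which [B] becomes the standard inner product. *)
Lemma compression_isometry (R : realType) n m (A B : 'M[R]_n) (P : 'M[R]_(n, m))
    (W : 'M[R]_n) (V : 'M[R]_m) (d : 'rV[R]_n) (e : 'rV[R]_m) :
  W *m B *m W^T = 1%:M -> W *m A *m W^T = diag_mx d ->
  V *m (P^T *m B *m P) *m V^T = 1%:M ->
  V *m (P^T *m A *m P) *m V^T = diag_mx e ->
  exists F : 'M[R]_(m, n),
    F *m F^T = 1%:M /\ F *m diag_mx d *m F^T = diag_mx e.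
Proof.
move=> WB WA VB VA.
have Wu := unit_of_congr1 WB.
pose F := V *m P^T *m invmx W.
have FE C : F *m (W *m C *m W^T) *m F^T = V *m (P^T *m C *m P) *m V^T.
  rewrite /F !trmx_mul trmxK -!mulmxA mulKmx // [W^T *m _]mulmxA.
  by rewrite -[W^T *m (invmx W)^T]trmx_mul mulVmx // trmx1 mul1mx.
exists F; split; last by rewrite -WA FE.
by rewrite -VB -FE WB mulmx1.
Qed.

(** With [t] the [k]-th eigenvalue of the compression, at least [k] eigenvalues of
    the compression, hence of the pencil itself, are at most [t]. *)
Lemma eig_low_compress (R : realType) n m (A B : 'M[R]_n) (P : 'M[R]_(n, m)) k :
  A \is symmetricmx -> spd B -> row_free P^T -> (0 < k <= m)%N ->
  eig_low A B k <= eig_low (P^T *m A *m P) (P^T *m B *m P) k.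
Proof.
move=> As Bp Pf /andP[k0 km].
have [W [d [WB WA]]] := spd_pencil_diag As Bp.
have := symmetricmx_congr P^T As; have := spd_congr Bp Pf; rewrite trmxK.
move=> Bp' As'; have [V [e [VB VA]]] := spd_pencil_diag As' Bp'.
have [F [FF FdF]] := compression_isometry WB WA VB VA.
rewrite /eig_low (pencil_eigs_diag WB WA) (pencil_eigs_diag VB VA).
set t := (X in _ <= X).
apply: nth_count_le; first exact: sort_le_sorted.
rewrite prednK // (permP (permEl (perm_sort _ _))).
apply: leq_trans (isometry_count_le t FF FdF).
rewrite -(permP (permEl (perm_sort <=%R _))) leqNgt; apply/negP => lt.
have := @nth_count_gt _ _ t 0 _ k.-1 (sort_le_sorted (codom (e 0))).
by rewrite -/t ltxx size_sort size_codom card_ord -ltnS prednK // lt km => /(_ isT).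
Qed.

Lemma eig_high_compress (R : realType) n m (A B : 'M[R]_n) (P : 'M[R]_(n, m)) l :
  A \is symmetricmx -> spd B -> row_free P^T -> (0 < l <= m)%N ->
  eig_high (P^T *m A *m P) (P^T *m B *m P) l <= eig_high A B l.
Proof.
move=> As Bp Pf /andP[l0 lm].
have mn : (m <= n)%N by rewrite -(eqP Pf) rank_leq_col.
have [W [d [WB WA]]] := spd_pencil_diag As Bp.
have := symmetricmx_congr P^T As; have := spd_congr Bp Pf; rewrite trmxK.
move=> Bp' As'; have [V [e [VB VA]]] := spd_pencil_diag As' Bp'.
have [F [FF FdF]] := compression_isometry WB WA VB VA.
rewrite /eig_high (pencil_eigs_diag WB WA) (pencil_eigs_diag VB VA).
have size_eigs p (f : 'rV[R]_p) : size (sort <=%R (codom (f 0))) = p.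
  by rewrite size_sort size_codom card_ord.
rewrite !nth_rev ?size_eigs ?prednK // ?(leq_trans lm) //.
set t := (X in X <= _).
apply: nth_count_ge; first exact: sort_le_sorted.
rewrite size_eigs ltn_subrL l0 (leq_trans l0 (leq_trans lm mn)) andbT.
rewrite count_lt_ge size_eigs leq_sub2l //.
rewrite (permP (permEl (perm_sort _ _))).
apply: leq_trans (isometry_count_ge t FF FdF).
rewrite -(permP (permEl (perm_sort <=%R _))) leqNgt; apply/negP => lt.
have := @nth_count_lt _ _ t 0 _ (m - l) (sort_le_sorted (codom (e 0))).
by rewrite -/t ltxx count_lt_ge size_eigs ltn_sub2l ?(leq_trans lt) // => /(_ isT).
Qed.

(** * A pair attaining equality *)

Lemma sort_cat_nseq (R : realType) (s : seq R) nu q :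
  (0 < nu <= size s)%N ->
  sort <=%R (s ++ nseq q (nth 0 (sort <=%R s) nu.-1)) =
  take nu (sort <=%R s) ++ nseq q (nth 0 (sort <=%R s) nu.-1) ++
  drop nu (sort <=%R s).
Proof.
move=> /andP[nu0 nus]; set s' := sort _ s; set c := nth _ _ _.
have ss' : sorted <=%R s' by exact: sort_le_sorted.
have sz : size s' = size s by rewrite size_sort.
have le_nth i j : (i <= j < size s)%N -> nth 0 s' i <= nth 0 s' j.
  move=> /andP[ij js]; apply: (sorted_leq_nth le_trans lexx) => //.
  - by rewrite inE sz (leq_ltn_trans ij).
  - by rewrite inE sz.
apply: (sorted_eq le_trans le_anti); first exact: sort_le_sorted.
  rewrite (sorted_pairwise le_trans) !pairwise_cat allrel_catr.
  move: (ss'); rewrite (sorted_pairwise le_trans) -{1}(cat_take_drop nu s').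
  rewrite pairwise_cat => /and3P[-> -> ->]; rewrite !andbT /=.
  apply/and3P; split.
  - apply/allrelP => x y /(nthP 0)[j]; rewrite size_take_min sz => + <-.
    rewrite leq_min => /andP[jnu js] /nseqP[-> _].
    by rewrite nth_take // le_nth // -ltnS prednK // jnu.
  - apply/allrelP => x y /nseqP[-> _] /(nthP 0)[j]; rewrite size_drop sz => jlt <-.
    by rewrite nth_drop le_nth // -ltn_subRL jlt (leq_trans (leq_pred _)) ?leq_addr.
  - apply/(pairwiseP 0) => i j; rewrite !inE size_nseq => iq jq _.
    by rewrite !nth_nseq iq jq.
by rewrite perm_sort perm_catC perm_sym perm_catCA perm_cat2l cat_take_drop perm_sort.
Qed.

Lemma codom_row_mx_const (R : realType) m q (e : 'rV[R]_m) (c : R) :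
  perm_eq (codom ((row_mx e (const_mx c : 'rV_q)) 0)) (codom (e 0) ++ nseq q c).
Proof.
apply/permP => p; rewrite count_cat count_nseq -!sum1_count !big_map.
rewrite big_split_ord /=; congr (_ + _)%N.
  by apply: eq_bigl => i; rewrite row_mxEl.
under eq_bigl => i do rewrite row_mxEr mxE.
rewrite big_mkcond /= sum_nat_const card_ord mulnC.
by case: (p c).
Qed.

Lemma pencil_diag_gt0 (R : realType) m (H G V : 'M[R]_m) (e : 'rV[R]_m) :
  spd H -> V *m G *m V^T = 1%:M -> V *m H *m V^T = diag_mx e ->
  forall i, 0 < e 0 i.
Proof.
move=> Hp VG VH; apply/spd_diag_mx; rewrite -VH; apply: spd_congr => //.
by rewrite row_free_unit (unit_of_congr1 VG).
Qed.

(** [T] is the completed basis: its first [m] rows are the diagonalizing basis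
    [V P^T] of the range of [P], its other rows are an arbitrary completion.  In this basis [P^T] is
    [(V^-1 | 0)], so the compression of a block diagonal matrix only sees the
    first block ([restr]), and choosing this block as for [(K, M)] meets the
    constraints ([unrestr]). *)
Lemma exists_pair_repeating_eig (R : realType) m q (K M : 'M[R]_(m + q))
    (P : 'M[R]_(m + q, m)) nu :
  spd K -> spd M -> row_free P^T -> (0 < nu <= m)%N ->
  let s := pencil_eigs (P^T *m K *m P) (P^T *m M *m P) in
  exists A B, constrained_pair K M P A B /\
    pencil_eigs A B = take nu s ++ nseq q (nth 0 s nu.-1) ++ drop nu s.
Proof.
move=> Kp Mp Pf nu_bnd s.
have := spd_congr Kp Pf; have := spd_congr Mp Pf; rewrite trmxK => Gp Hp.
have [V [e [VG VH]]] := spd_pencil_diag (proj1 Hp) Gp.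
have Vu := unit_of_congr1 VG.
have sE : s = sort <=%R (codom (e 0)) by exact: pencil_eigs_diag VG VH.
have sz : size s = m by exact: size_pencil_eigs (proj1 Hp) Gp.
set c := nth 0 s nu.-1.
have e0 := pencil_diag_gt0 Hp VG VH.
have c0 : 0 < c.
  have : c \in s by rewrite mem_nth // sz; case: nu nu_bnd {c}.
  by rewrite sE mem_sort => /codomP[i ->].
have [U Uu UP] := row_free_extend Pf.
pose T := block_mx V 0 0 1%:M *m U.
have Tu : T \in unitmx by rewrite unitmx_mul block_diag_mx_unit Vu unitmx1.
have Ti : row_free (invmx T) by rewrite row_free_unit unitmx_inv.
have PT : P^T = row_mx (invmx V) 0 *m T.
  rewrite mulmxA mul_row_block mulVmx // !mulmx0 !mul0mx !addr0.
  by rewrite -[U]vsubmxK UP mul_row_col mul1mx mul0mx addr0.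
clearbody T.
have restr (D1 : 'M_m) (D2 : 'M_q) :
    P^T *m (invmx T *m block_mx D1 0 0 D2 *m (invmx T)^T) *m P =
    invmx V *m D1 *m (invmx V)^T.
  rewrite -[X in _ *m X = _]trmxK PT trmx_mul !mulmxA mulmxK //.
  rewrite -[_ *m (invmx T)^T *m _]mulmxA -trmx_mul mulmxV // trmx1 mulmx1.
  rewrite mul_row_block !mulmx0 !mul0mx !addr0 tr_row_mx mul_row_col.
  by rewrite mul0mx addr0.
have unrestr (D N : 'M_m) : V *m N *m V^T = D -> invmx V *m D *m (invmx V)^T = N.
  move=> <-; rewrite !mulmxA mulVmx // mul1mx -mulmxA -trmx_mul mulVmx //.
  by rewrite trmx1 mulmx1.
have diagT D : T *m (invmx T *m D *m (invmx T)^T) *m T^T = D.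
  rewrite !mulmxA mulmxV // mul1mx -mulmxA -trmx_mul mulmxV //.
  by rewrite trmx1 mulmx1.
pose d := row_mx e (const_mx c : 'rV_q).
exists (invmx T *m diag_mx d *m (invmx T)^T), (invmx T *m 1%:M *m (invmx T)^T).
split; first split.
- apply: spd_congr => //; apply/spd_diag_mx => i.
  by case: (split_ordP i) => j ->; rewrite ?row_mxEl ?row_mxEr ?mxE.
- apply: spd_congr => //; rewrite -diag_const_mx; apply/spd_diag_mx => i.
  by rewrite mxE ltr01.
- by rewrite mulmxBr mulmxBl diag_mx_row restr (unrestr _ _ VH) subrr.
- by rewrite mulmxBr mulmxBl scalar_mx_block restr (unrestr _ _ VG) subrr.
rewrite (pencil_eigs_diag (diagT _) (diagT _)).
rewrite (perm_sort_leP _ _ (codom_row_mx_const q e c)).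
by rewrite /c sE sort_cat_nseq // size_codom card_ord.
Qed.

Lemma row_free_of_basis (R : realType) n m (U : {vspace 'cV[R]_n})
    (P : 'M[R]_(n, m)) :
  basis_of U [seq col j P | j <- enum 'I_m] -> row_free P^T.
Proof.
move=> /basis_free Pf; rewrite -kermx_eq0; apply/rowV0P => v /sub_kermxP vP.
have sz : size [seq col j P | j <- enum 'I_m] = m by rewrite size_map size_enum_ord.
have /freeP indep : free (Tuple (introT eqP sz)) by [].
apply/rowP => j; rewrite mxE; apply: (indep (v 0)).
apply: trmx_inj; rewrite trmx0 -vP mulmx_sum_row linear_sum.
apply: eq_bigr => i _; rewrite linearZ /= -tr_col.
by rewrite (nth_map i) ?size_enum_ord // nth_ord_enum.
Qed.

Theorem theorem1p2 (R : realType) (n m : nat) (K M : 'M[R]_n)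
    (calP : {vspace 'cV[R]_n}) (P : 'M[R]_(n, m))
    (spdK : spd K) (spdM : spd M)
    (dimP : \dim calP = m) (ltmn : (m < n)%N)
    (basisP : basis_of calP [seq col j P | j <- enum 'I_m])
    (nu pi : nat) (nu_gt0 : (0 < nu)%N) (pi_gt0 : (0 < pi)%N)
    (nu_pi : (nu + pi)%N = m) :
  (forall A B : 'M[R]_n, constrained_pair K M P A B ->
     (forall k : nat, (1 <= k <= nu)%N ->
        eig_low A B k <= eig_low (P^T *m K *m P) (P^T *m M *m P) k) /\
     (forall l : nat, (1 <= l <= pi)%N ->
        eig_high (P^T *m K *m P) (P^T *m M *m P) l <= eig_high A B l)) /\
  (exists A B : 'M[R]_n,
     [/\ constrained_pair K M P A B,
         forall k : nat, (1 <= k <= nu)%N ->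
           eig_low A B k = eig_low (P^T *m K *m P) (P^T *m M *m P) k
       & forall l : nat, (1 <= l <= pi)%N ->
           eig_high (P^T *m K *m P) (P^T *m M *m P) l = eig_high A B l]).
Proof.
have Pf := row_free_of_basis basisP.
split=> [A B [Ap Bp AK BM] | ].
  have -> : P^T *m K *m P = P^T *m A *m P.
    by apply/esym/eqP; rewrite -subr_eq0 -mulmxBl -mulmxBr AK.
  have -> : P^T *m M *m P = P^T *m B *m P.
    by apply/esym/eqP; rewrite -subr_eq0 -mulmxBl -mulmxBr BM.
  split=> [k /andP[k0 knu] | l /andP[l0 lpi]].
    apply: eig_low_compress => //; first exact: (proj1 Ap).
    by rewrite k0 (leq_trans knu) // -nu_pi leq_addr.
  apply: eig_high_compress => //; first exact: (proj1 Ap).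
  by rewrite l0 (leq_trans lpi) // -nu_pi leq_addl.
have [q nE] : exists q, n = (m + q)%N by exists (n - m)%N; rewrite subnKC // ltnW.
subst n.
have nu_bnd : (0 < nu <= m)%N by rewrite nu_gt0 -nu_pi leq_addr.
have [A [B [AB eigsE]]] := exists_pair_repeating_eig spdK spdM Pf nu_bnd.
have sz : size (pencil_eigs (P^T *m K *m P) (P^T *m M *m P)) = m.
  have := spd_congr spdK Pf; have := spd_congr spdM Pf; rewrite trmxK => Gp Hp.
  exact: size_pencil_eigs (proj1 Hp) Gp.
have mnu : (m - nu = pi)%N by rewrite -nu_pi addKn.
exists A, B; split=> // [k /andP[k0 knu] | l /andP[l0 lpi]].
  rewrite /eig_low eigsE nth_cat size_takel ?sz ?(andP nu_bnd).2 //.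
  by rewrite prednK // knu nth_take // prednK.
rewrite /eig_high eigsE -{1}(cat_take_drop nu (pencil_eigs _ _)) !rev_cat.
rewrite -catA !nth_cat size_rev size_drop sz mnu.
by rewrite prednK // lpi.
Qed.
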